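(* As $n\to\infty$, $$\mathbb P_n(\mathcal F\text{ is non-trivial})=\frac{R(n)}{W(n)}=(3+o(1))\,2^{-2^{n-1}}.$$
   Context: $[n]=\{1,\dots,n\}$; $V_n$ is the set of nonempty subsets of $[n]$. A family $\mathcal F\subseteq V_n$ is intersecting if $A\cap B\ne\varnothing$ for all $A,B\in\mathcal F$ (the empty family is intersecting). Its kernel is $\ker\mathcal F=\bigcap_{S\in\mathcal F}S$, with $\ker\varnothing=[n]$; it is non-trivial (non-condensed) if $\ker\mathcal F=\varnothing$. The weight is $w(S)=2^{2^{n-|S|}}-1$. $W(n)=\sum_{\mathcal F}\prod_{S\in\mathcal F}w(S)$ over all intersecting families $\mathcal F\subseteq V_n$ (empty product $=1$), and $R(n)$ is the same sum restricted to non-trivial families. $\mathbb P_n$ is the probability distribution on intersecting families given by $\mathbb P_n(\mathcal F)=\prod_{S\in\mathcal F}w(S)/W(n)$. *)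

(* Defs.v *)
From mathcomp Require Import all_boot all_order all_algebra.

Set Implicit Arguments.
Unset Strict Implicit.
Unset Printing Implicit Defensive.

Import Order.TTheory GRing.Theory Num.Theory.

(* The ground set [n] = {1, ..., n} is represented by 'I_n. *)

Definition vset (n : nat) : {set {set 'I_n}} := [set S | S != set0].

Definition intersecting (n : nat) (F : {set {set 'I_n}}) : bool :=
  (F \subset vset n) && [forall A in F, forall B in F, A :&: B != set0].

(* The empty intersection is [set: 'I_n], so ker set0 is the ground set. *)
Definition ker (n : nat) (F : {set {set 'I_n}}) : {set 'I_n} :=
  \bigcap_(S in F) S.

Definition nontrivial (n : nat) (F : {set {set 'I_n}}) : bool :=
  ker F == set0.

(* Neither subtraction truncates: #|S| <= n and 1 <= 2 ^ k. *)
Definition weight (n : nat) (S : {set 'I_n}) : nat :=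
  2 ^ (2 ^ (n - #|S|)) - 1.

Definition fweight (n : nat) (F : {set {set 'I_n}}) : nat :=
  \prod_(S in F) weight S.

Definition W (n : nat) : nat :=
  \sum_(F : {set {set 'I_n}} | intersecting F) fweight F.

Definition R (n : nat) : nat :=
  \sum_(F : {set {set 'I_n}} | intersecting F && nontrivial F) fweight F.

Local Open Scope ring_scope.

(* The distribution lives on the intersecting families; it is extended by 0 to
   all sets of subsets of 'I_n. *)
Definition pmf (K : realFieldType) (n : nat) (F : {set {set 'I_n}}) : K :=
  if intersecting F then (fweight F)%:R / (W n)%:R else 0.

Definition Pr (K : realFieldType) (n : nat) (E : pred {set {set 'I_n}}) : K :=
  \sum_(F : {set {set 'I_n}} | E F) pmf K F.

Lemma W_gt0 (n : nat) : (0 < W n)%N.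
Proof.
rewrite /W (bigD1 set0) /=; first by rewrite /fweight big_set0.
rewrite /intersecting sub0set /=.
by apply/forall_inP => A; rewrite inE.
Qed.

Lemma pmf_ge0 (K : realFieldType) (n : nat) (F : {set {set 'I_n}}) :
  0 <= pmf K F.
Proof. by rewrite /pmf; case: ifP => // _; rewrite divr_ge0 ?ler0n. Qed.

Lemma Pr_total (K : realFieldType) (n : nat) : Pr K (@predT {set {set 'I_n}}) = 1.
Proof.
rewrite /Pr /pmf -big_mkcond /= -mulr_suml -natr_sum divff //.
by rewrite pnatr_eq0 -lt0n W_gt0.
Qed.

(* Main.v *)
(* A maximal intersecting family M is self-dual: it contains exactly one of S and
   its complement.  Summing the weights over the subfamilies of M gives 2^(mu M),
   where mu M is the sum of 2^(n-|S|) over the members S of M, and a star has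
   mu = 3^(n-1).  Pairing level k of M with level n-k, the Erdos-Ko-Rado theorem
   bounds the deficit 3^(n-1) - mu M below by the contributions of levels 1 and 2:
   a family without singletons loses about 2^(n-1), and each missing pair loses
   about 2^(n-2) more.  There are at most 2^(2^(n-1)) self-dual families, so those
   lacking at least three pairs are negligible; if one or two pairs are missing,
   the pairs form a star at some i and the family is determined by its few members
   avoiding i, all of size at least n-3.  If no pair is missing, the family is the
   star at i with {i} exchanged for [n] \ {i}, and the n choices of i give the
   main term, [n] \ {i} having weight 3. *)

Require Import Defs.
From mathcomp Require Import all_boot all_order all_algebra.
From mathcomp Require Import all_fingroup all_solvable.
From mathcomp Require Import zify lra.
Import Order.TTheory GRing.Theory Num.Theory.

Set Implicit Arguments.
Unset Strict Implicit.
Unset Printing Implicit Defensive.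

(** * Sums over subsets; transitivity of permutations on k-sets *)

(** Expanding the product, each factor [w x + 1] chooses whether x belongs to F; setting w to 0
    outside A kills every F not contained in A. *)
Lemma sum_prod_subset (T : finType) (A : {set T}) (w : T -> nat) :
  \sum_(F : {set T} | F \subset A) \prod_(x in F) w x = \prod_(x in A) (w x).+1.
Proof.
pose v x := if x \in A then w x else 0.
have -> : \prod_(x in A) (w x).+1 = \prod_x (v x + 1).
  rewrite big_mkcond; apply: eq_bigr => x _; rewrite /v.
  by case: ifP => _; rewrite ?addn1.
rewrite bigA_distr big_mkcond; apply: eq_bigr => F _.
case: ifP => [/subsetP FA | /negbT /subsetPn [x xF xA]].
  rewrite [LHS]big_mkcond; apply: eq_bigr => x _.
  by case: ifP => // /FA xA; rewrite /v xA.
by rewrite (bigD1 x) //= xF /v (negbTE xA).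
Qed.

(** List A first and its complement after it: the symmetric group is transitive on such
    duplicate-free listings of T. *)
Lemma exists_perm_imset (T : finType) (A B : {set T}) :
  #|A| = #|B| -> exists s : {perm T}, s @: A = B.
Proof.
move=> eAB.
have size_enum (C : {set T}) : size (enum C ++ enum (~: C)) == #|T|.
  by rewrite size_cat -!cardE cardsC.
have uniq_enum (C : {set T}) : uniq (enum C ++ enum (~: C)).
  rewrite cat_uniq !enum_uniq andbT /=; apply/hasPn => x /=.
  by rewrite !mem_enum inE.
have dt C : Tuple (size_enum C) \in #|T|.-dtuple(setT).
  by rewrite inE /= uniq_enum /=; apply/subsetP.
have [s _ es] := atransP2 (Sym_trans T) (dt A) (dt B).
exists s; move/(congr1 val): es => /=.
rewrite map_cat => /eqP; rewrite eqseq_cat ?size_map -?cardE //.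
case/andP => /eqP es _; apply/setP => x.
rewrite -[RHS]mem_enum es; apply/imsetP/mapP => -[y yA ->];
  exists y => //; move: yA; by rewrite mem_enum.
Qed.

(** * The Erdos-Ko-Rado theorem by Katona's cycle method *)

Section Katona.

Variables (n k : nat).
Implicit Types (i j x : 'I_n) (s : {perm 'I_n}) (A B S : {set 'I_n}).

(* The residue of x - j modulo n, for j, x < n. *)
Definition cdist (j x : nat) : nat := if j <= x then x - j else x + n - j.

Definition arc j : {set 'I_n} := [set x : 'I_n | cdist j x < k].

Lemma card_arc j : k <= n -> #|arc j| = k.
Proof.
move=> kn.
have dist_lt (x : 'I_n) : cdist j x < n.
  by rewrite /cdist; case: ifP; have := ltn_ord j; have := ltn_ord x; lia.
pose f x := Ordinal (dist_lt x).
have finj : injective f.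
  move=> x y /(congr1 val) /= e; apply: val_inj => /=; move: e.
  by rewrite /cdist; repeat case: ifP; have := ltn_ord j;
    have := ltn_ord x; have := ltn_ord y; lia.
have -> : arc j = f @^-1: [set x : 'I_n | x < k] by apply/setP => x; rewrite !inE.
by rewrite card_preimset // -sum1dep_card (big_ord_narrow kn) sum1_card card_ord.
Qed.

(** Fix one arc, at [j0]. Every other start lies less than k steps after or before [j0]. Starts at
    distances d and [d + (n - k)] give disjoint arcs, so identifying them maps J injectively into k
    values. *)
Lemma katona_cycle (J : {set 'I_n}) : 0 < k -> k.*2 <= n ->
  {in J &, forall i j, arc i :&: arc j != set0} -> #|J| <= k.
Proof.
move=> k0 kn meetJ.
have far i j : i \in J -> j \in J -> (cdist i j < k) || (n - k < cdist i j).
  move=> iJ jJ; have /set0Pn [x] := meetJ i j iJ jJ.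
  rewrite !inE /cdist => /andP [].
  by repeat case: ifP; have := ltn_ord j; have := ltn_ord x; have := ltn_ord i; lia.
case: (set_0Vmem J) => [-> | [j0 j0J]]; first by rewrite cards0.
pose h i := if cdist j0 i < k then cdist j0 i else cdist j0 i - (n - k).
have h_lt i : h i < n.
  rewrite /h /cdist.
  by repeat case: ifP; have := ltn_ord j0; have := ltn_ord i; lia.
pose f i := Ordinal (h_lt i).
have finj : {in J &, injective f}.
  move=> x y xJ yJ /(congr1 val) /= e; apply: val_inj => /=.
  have := far _ _ xJ yJ; have := far _ _ yJ xJ.
  have := far _ _ j0J yJ; have := far _ _ j0J xJ.
  move: e; rewrite /h /cdist.
  have := ltn_ord j0; have := ltn_ord x; have := ltn_ord y.
  case: (leqP j0 x); case: (leqP j0 y); case: (leqP x y); case: (leqP y x);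
    by repeat case: ifP; lia.
rewrite -(card_in_imset finj).
have kn' : k <= n by lia.
have <- : #|[set x : 'I_n | x < k]| = k.
  by rewrite -sum1dep_card (big_ord_narrow kn') sum1_card card_ord.
apply: subset_leq_card; apply/subsetP => _ /imsetP [x xJ ->]; rewrite inE /= /h.
have := far _ _ j0J xJ; rewrite /cdist.
have := ltn_ord j0; have := ltn_ord x.
by repeat case: ifP; lia.
Qed.

(** Composing with a permutation that carries S to B shows that all k-sets S are images of A equally
    often, so the n! permutations split evenly among ['C(n, k)] classes. *)
Lemma card_perm_imset A B : #|A| = k -> #|B| = k ->
  #|[set s : {perm 'I_n} | s @: A == B]| * 'C(n, k) = n`!.
Proof.
move=> cA cB.
have same S : #|S| = k ->
    #|[set s : {perm 'I_n} | s @: A == S]| = #|[set s : {perm 'I_n} | s @: A == B]|.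
  move=> cS; have [t <-] := exists_perm_imset (etrans cS (esym cB)).
  rewrite -(card_preimset [set s : {perm 'I_n} | s @: A == t @: S] (mulIg t)).
  apply: eq_card => s; rewrite !inE.
  have -> : (s * t)%g @: A = t @: (s @: A).
    by rewrite -imset_comp; apply: eq_imset => x; rewrite permM.
  by rewrite (inj_eq (imset_inj (@perm_inj _ t))).
have -> : n`! = \sum_(s : {perm 'I_n}) 1 by rewrite sum1_card card_Sn.
rewrite (partition_big (fun s : {perm 'I_n} => s @: A)
  (mem [set S : {set 'I_n} | #|S| == k])) /=; last first.
  by move=> s _; rewrite inE card_imset ?cA //; apply: perm_inj.
rewrite (eq_bigr (fun=> #|[set s : {perm 'I_n} | s @: A == B]|)); last first.
  move=> S; rewrite inE => /eqP cS; rewrite -(same S cS) -sum1dep_card.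
  by apply: eq_bigl => s; rewrite ?inE.
by rewrite sum_nat_const; move: (card_draws 'I_n k); rewrite card_ord mulnC => <-.
Qed.

(* Katona's averaging: each permuted cyclic order carries at most k of its n
   arcs in M, and every k-set is an arc equally often. *)
Lemma erdos_ko_rado (M : {set {set 'I_n}}) : 0 < k -> k.*2 <= n ->
  {in M, forall S, #|S| = k} -> {in M &, forall A B, A :&: B != set0} ->
  #|M| <= 'C(n.-1, k.-1).
Proof.
move=> k0 kn cM meetM.
have n0 : 0 < n by lia.
have kn' : k <= n by lia.
have j0 : 'I_n := Ordinal n0.
pose N := #|[set s : {perm 'I_n} | s @: arc j0 == arc j0]|.
have cN : N * 'C(n, k) = n`! by apply: card_perm_imset; apply: card_arc.
have C0 : 0 < 'C(n, k) by rewrite bin_gt0.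
have N0 : 0 < N by have := fact_gt0 n; rewrite -cN muln_gt0 => /andP [].
have N_eq j S : #|S| = k -> #|[set s : {perm 'I_n} | s @: arc j == S]| = N.
  move=> cS; apply/eqP; rewrite -(eqn_pmul2r C0) cN; apply/eqP.
  by apply: card_perm_imset => //; apply: card_arc.
have : \sum_(s : {perm 'I_n}) \sum_(j | s @: arc j \in M) 1 <=
       \sum_(s : {perm 'I_n}) k.
  apply: leq_sum => s _; rewrite sum1dep_card; apply: katona_cycle => // i j.
  rewrite !inE => iM jM; move: (meetM _ _ iM jM).
  rewrite -imsetI; last by move=> ? ? _ _; apply: perm_inj.
  by apply: contraNneq => ->; rewrite imset0.
rewrite (exchange_big_dep predT) //= sum_nat_const.
rewrite (eq_bigr (fun=> #|M| * N)); last first.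
  move=> j _; rewrite (partition_big (fun s : {perm 'I_n} => s @: arc j) (mem M)) //=.
  rewrite (eq_bigr (fun=> N)) ?sum_nat_const // => S SM.
  rewrite -(N_eq j S (cM _ SM)) -sum1dep_card; apply: eq_bigl => s.
  by apply: andb_idl => /eqP ->.
rewrite sum_nat_const card_ord.
have -> : #|[eta {perm 'I_n}]| = n`! by rewrite -card_Sn; apply: eq_card.
rewrite -cN mulnA [N * _]mulnC -mulnA.
have := mul_bin_diag n k.-1; rewrite prednK // => e.
by rewrite mulnAC ['C(n, k) * k]mulnC -e mulnA leq_pmul2r // leq_pmul2l.
Qed.

End Katona.

(** * The exponent [mu] and the levels of a star *)

Definition mu (n : nat) (A : {set {set 'I_n}}) : nat :=
  \sum_(S in A) 2 ^ (n - #|S|).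

Definition star (n : nat) (i : 'I_n) : {set {set 'I_n}} :=
  [set S : {set 'I_n} | i \in S].

Definition level (n : nat) (M : {set {set 'I_n}}) (k : nat) : {set {set 'I_n}} :=
  [set S in M | #|S| == k].

Section Mu.

Variable n : nat.
Implicit Types (i : 'I_n) (S B : {set 'I_n}) (A M : {set {set 'I_n}}).

Lemma card_set_ord S : #|S| <= n.
Proof. by have := max_card (mem S); rewrite card_ord. Qed.

Lemma weightS S : (weight S).+1 = 2 ^ (2 ^ (n - #|S|)).
Proof. by rewrite /weight subn1 prednK // expn_gt0. Qed.

Lemma sum_fweight_subset A :
  \sum_(F : {set {set 'I_n}} | F \subset A) fweight F = 2 ^ mu A.
Proof.
rewrite sum_prod_subset expn_sum; apply: eq_bigr => S _; exact: weightS.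
Qed.

(** After complementation this is the expansion of a product of factors 1 + 2, one for each point
    outside B. *)
Lemma mu_supersets B : mu [set S : {set 'I_n} | B \subset S] = 3 ^ (n - #|B|).
Proof.
rewrite /mu (reindex_inj (@setC_inj 'I_n)) /=.
have -> : n - #|B| = #|~: B| by rewrite [RHS]cardsCs setCK card_ord.
rewrite -prod_nat_const -(sum_prod_subset (~: B) (fun=> 2)).
apply: eq_big => [S | S _]; first by rewrite inE subsetC.
by rewrite prod_nat_const [#|~: S|]cardsCs setCK card_ord subKn // card_set_ord.
Qed.

Lemma mu_star i : mu (star i) = 3 ^ n.-1.
Proof.
have := mu_supersets [set i]; rewrite cards1 subn1 => <-; congr (mu _).
by apply/setP => S; rewrite !inE sub1set.
Qed.

Lemma muE M : mu M = \sum_(0 <= k < n.+1) #|level M k| * 2 ^ (n - k).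
Proof.
rewrite big_mkord /mu.
have cS S : #|S| < n.+1 by rewrite ltnS card_set_ord.
rewrite (partition_big (fun S => Ordinal (cS S)) predT) //=.
apply: eq_bigr => k _; rewrite -sum_nat_const.
apply: eq_big => [S | S /andP [_ /eqP <-]] //.
by rewrite inE.
Qed.

Lemma card_level_star i k : 0 < k -> #|level (star i) k| = 'C(n.-1, k.-1).
Proof.
case: k => // k _ /=.
have n0 : 0 < n by have := ltn_ord i; lia.
(* Pascal's rule separates the sets containing i from those avoiding it; the latter are counted
   directly and cancelled. *)
have Cn : 'C(n, k.+1) = 'C(n.-1, k) + 'C(n.-1, k.+1).
  by rewrite -{1}(prednK n0) binS addnC.
have cC : #|~: [set i]| = n.-1 by rewrite cardsC1 card_ord.
have := card_draws 'I_n k.+1; rewrite card_ord Cn -{2}cC -cards_draws.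
rewrite -(cardsID (star i) [set S : {set 'I_n} | _]) => e.
apply: (@addIn #|[set S : {set 'I_n} | (S \subset ~: [set i]) && (#|S| == k.+1)]|).
rewrite -e; congr (_ + _); apply: eq_card => S; rewrite !inE.
  by rewrite andbC.
by rewrite subsetC sub1set inE.
Qed.

End Mu.

(** * Self-dual families and the deficit inequality *)

Definition selfdual (n : nat) (M : {set {set 'I_n}}) : bool :=
  intersecting M && [forall S, (~: S \in M) == (S \notin M)].

Section SelfDual.

Variable n : nat.
Implicit Types (i : 'I_n) (S B : {set 'I_n}) (F M : {set {set 'I_n}}).

Lemma intersectingP F :
  reflect {in F &, forall A B, A :&: B != set0} (intersecting F).
Proof.
apply: (iffP andP) => [[_ /forall_inP FF] A B AF BF | FF].
  by move/forall_inP: (FF _ AF); apply.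
split; last by apply/forall_inP => A AF; apply/forall_inP => B; apply: FF.
by apply/subsetP => A AF; rewrite inE -[A]setIid FF.
Qed.

Lemma selfdualP M : reflect
  ({in M &, forall A B, A :&: B != set0} /\ forall S, (~: S \in M) = (S \notin M))
  (selfdual M).
Proof.
apply: (iffP andP) => [[/intersectingP MM /forallP sdM] | [MM sdM]].
  by split=> // S; apply/eqP.
by split; [apply/intersectingP | apply/forallP => S; apply/eqP].
Qed.

Lemma selfdual_star i : selfdual (star i).
Proof.
apply/selfdualP; split=> [A B|S]; last by rewrite !inE.
by rewrite !inE => iA iB; apply/set0Pn; exists i; rewrite inE iA.
Qed.

(** Take M maximal above F. If S is not in M, maximality yields a member A disjoint from S; every
    member meets A, hence meets [~: S], and maximality puts [~: S] into M. *)
Lemma selfdual_extension F : 0 < n -> intersecting F ->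
  exists2 M, selfdual M & F \subset M.
Proof.
move=> n0 /maxset_exists [M /maxsetP [Mint Mmax] FM]; exists M => //.
have /intersectingP MM := Mint.
apply/selfdualP; split=> // S; apply/idP/idP => [SCM | SM].
  by apply/negP => SM; have := MM _ _ SM SCM; rewrite setICr eqxx.
(* The empty set is treated apart, since it does not meet itself; its complement, the ground set, is
   nonempty because [0 < n]. *)
have [S0 | Sn0] := eqVneq S set0.
  have <- : ~: S |: M = M; last by rewrite setU11.
  apply: Mmax; last exact: subsetUr.
  apply/intersectingP => A B; rewrite S0 setC0 !inE.
  have ex : [set: 'I_n] != set0 by rewrite -cards_eq0 cardsT card_ord -lt0n.
  case/orP=> [/eqP -> | AM]; case/orP=> [/eqP -> | BM]; rewrite ?setTI ?setIT //.
  - by rewrite -[B]setIid MM.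
  - by rewrite -[A]setIid MM.
  - exact: MM.
have [A AM /eqP AS] : exists2 A, A \in M & A :&: S == set0.
  apply/exists_inP; apply: contraNT SM => /exists_inPn meetS.
  have <- : S |: M = M; last by rewrite setU11.
  apply: Mmax; last exact: subsetUr.
  apply/intersectingP => A B; rewrite !inE.
  case/orP=> [/eqP -> | AM]; case/orP=> [/eqP -> | BM]; rewrite ?setIid //.
  - by rewrite setIC meetS.
  - exact: meetS.
  - exact: MM.
have ASC : A \subset ~: S by rewrite -disjoints_subset -setI_eq0 AS.
have <- : ~: S |: M = M; last by rewrite setU11.
have An0 B : B \in M -> ~: S :&: B != set0.
  by move=> BM; apply: contraNneq (MM _ _ AM BM) => e; rewrite -subset0 -e setSI.
apply: Mmax; last exact: subsetUr.
apply/intersectingP => B C; rewrite !inE.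
case/orP=> [/eqP -> | BM]; case/orP=> [/eqP -> | CM].
- by rewrite setIid -[~: S]setIid; apply: contraNneq (An0 _ AM) => e;
    rewrite -subset0 -e setIid subsetIl.
- exact: An0.
- by rewrite setIC An0.
- exact: MM.
Qed.

Lemma level_le_star i M k :
  selfdual M -> k.*2 <= n -> #|level M k| <= #|level (star i) k|.
Proof.
case/selfdualP=> MM _ kn; have [-> | k0] := posnP k.
  rewrite (_ : level M 0 = set0) ?cards0 //; apply/setP => S; rewrite !inE.
  by apply/negP => /andP [/[dup] SM /MM /(_ SM)];
    rewrite setIid cards_eq0 => /negbTE ->.
rewrite card_level_star //; apply: erdos_ko_rado => // [S | A B].
  by rewrite inE => /andP [_ /eqP].
by rewrite !inE => /andP [AM _] /andP [BM _]; apply: MM.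
Qed.

(** Complementation matches the k-sets outside M with the (n - k)-sets inside M. *)
Lemma level_selfdual M k : selfdual M -> k <= n ->
  #|level M k| + #|level M (n - k)| = 'C(n, k).
Proof.
case/selfdualP=> _ sdM kn.
have := card_draws 'I_n k; rewrite card_ord => <-.
rewrite -(cardsID M [set S : {set 'I_n} | #|S| == k]); congr (_ + _).
  by apply: eq_card => S; rewrite !inE andbC.
rewrite -(card_preimset (level M (n - k)) (@setC_inj 'I_n)).
apply: eq_card => S; rewrite !inE sdM [#|~: S|]cardsCs setCK card_ord.
by congr (_ && _); have := card_set_ord S; lia.
Qed.

(* Pairing level k with level n - k turns the deficit into a sum of terms
   (c_k(star) - c_k(M)) (2^(n-k) - 2^k), all nonnegative by Erdos-Ko-Rado. *)
Lemma mu_deficit M : 4 < n -> selfdual M ->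
  mu M + (1 - #|level M 1|) * (2 ^ (n - 1) - 2)
       + (n - 1 - #|level M 2|) * (2 ^ (n - 2) - 4) <= 3 ^ (n - 1).
Proof.
move=> n4 sdM; pose i : 'I_n := Ordinal (ltn_trans (isT : 0 < 4) n4).
have -> : 3 ^ (n - 1) = mu (star i) by rewrite mu_star subn1.
pose d k : int := (#|level (star i) k|%:Z - #|level M k|%:Z)%R.
pose t k : int := (d k * ((2 ^ (n - k))%:Z - (2 ^ k)%:Z))%R.
have dN k : k <= n -> (d (n - k)%N = - d k)%R.
  move=> kn; have := level_selfdual sdM kn.
  have := level_selfdual (selfdual_star i) kn; rewrite /d; lia.
have d_ge0 k : k.*2 <= n -> (0 <= d k)%R.
  by move=> /(level_le_star i sdM); rewrite /d; lia.
have tN k : k <= n -> t (n - k) = t k.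
  by move=> kn; rewrite /t dN // subKn // mulNr -mulrN opprB.
have t_ge0 k : k <= n -> (0 <= t k)%R.
  have small j : j.*2 <= n -> (0 <= t j)%R.
    move=> jn; apply: mulr_ge0; first exact: d_ge0.
    by rewrite subr_ge0 lez_nat leq_exp2l //; lia.
  move=> kn; case: (leqP k.*2 n) => k2; first exact: small.
  by rewrite -tN // small //; lia.
(* The factor 2 arises because the sums of [d k * 2 ^ (n - k)] and of [- d k * 2 ^ k] are reversals
   of each other, each equal to the deficit. *)
have sumE : (\sum_(k < n.+1) t k = 2 * ((mu (star i))%:Z - (mu M)%:Z))%R.
  have e : ((mu (star i))%:Z - (mu M)%:Z =
      \sum_(k < n.+1) d k * (2 ^ (n - k))%:Z)%R.
    rewrite !muE !big_mkord !(big_morph Posz PoszD (erefl _)) -sumrB.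
    by apply: eq_bigr => k _; rewrite !PoszM mulrBl.
  set D := (_ - _)%R in e *.
  have e2 : (D = - \sum_(k < n.+1) d k * (2 ^ k)%:Z)%R.
    rewrite e (reindex_inj rev_ord_inj) /= -sumrN; apply: eq_bigr => k _.
    have kn : k <= n by rewrite -ltnS.
    by rewrite subSS dN // subKn // mulNr.
  rewrite mulrDl mul1r {1}e e2 -sumrB.
  by apply: eq_bigr => k _; rewrite /t mulrBr.
have lt1 : 1 < n.+1 by lia.
have lt2 : 2 < n.+1 by lia.
have lt3 : n - 1 < n.+1 by lia.
have lt4 : n - 2 < n.+1 by lia.
(* Levels 1, 2, n - 1 and n - 2 are distinct since [4 < n]; all other terms are nonnegative and
   dropped. *)
have le_sum : (t 1 + t 2 + t 1 + t 2 <= \sum_(k < n.+1) t k)%R.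
  rewrite (bigD1 (Ordinal lt1)) // (bigD1 (Ordinal lt2)) //=.
  rewrite (bigD1 (Ordinal lt3)) /=; last by rewrite -!val_eqE /=; lia.
  rewrite (bigD1 (Ordinal lt4)) /=; last by rewrite -!val_eqE /=; lia.
  rewrite !tN; [|lia|lia].
  rewrite -!addrA !lerD2l -[leLHS]addr0 lerD2l sumr_ge0 // => k _.
  by rewrite t_ge0 // -ltnS.
have d1 : d 1 = (1 - #|level M 1|%:Z)%R.
  by rewrite /d card_level_star // bin0.
have d2 : d 2 = (n%:Z - 1 - #|level M 2|%:Z)%R.
  by rewrite /d card_level_star // bin1; lia.
(* These two bounds make the truncated subtractions of the statement exact. *)
have g1 := d_ge0 1 (ltnW (ltnW (ltnW n4))).
have g2 := d_ge0 2 (ltnW n4).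
move: le_sum; rewrite sumE /t d1 d2 => le_sum.
have p1 : 2 <= 2 ^ (n - 1) by rewrite -{1}(expn1 2) leq_exp2l //; lia.
have p2 : 4 <= 2 ^ (n - 2) by rewrite -[4]/(2 ^ 2) leq_exp2l //; lia.
rewrite d1 in g1; rewrite d2 in g2.
rewrite -lez_nat !PoszD !PoszM -!subzn //; try lia.
rewrite -[2 ^ 1]/2 -[2 ^ 2]/4 in le_sum.
move: le_sum; set x := (_ * _)%R; set y := (_ * _)%R; lia.
Qed.

End SelfDual.

(** * Intersecting pairs and inclusion-exclusion bounds *)

Lemma card2_set2 (T : finType) (A : {set T}) (x y : T) :
  #|A| = 2 -> x \in A -> y \in A -> x != y -> A = [set x; y].
Proof.
move=> A2 xA yA xy; apply/esym/eqP; rewrite eqEcard A2 cards2 xy andbT.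
by rewrite subUset !sub1set xA yA.
Qed.

(** Pairwise meeting edges form a star or a triangle, and a triangle has only three edges. *)
Lemma intersecting_edges_star (T : finType) (E : {set {set T}}) :
  {in E, forall A : {set T}, #|A| = 2} ->
  {in E &, forall A B : {set T}, A :&: B != set0} ->
  3 < #|E| -> exists i, {in E, forall A : {set T}, i \in A}.
Proof.
move=> E2 EE E3.
have /card_gt1P [A [B [AE BE AB]]] : 1 < #|E| by lia.
have /set0Pn [a] := EE _ _ AE BE; rewrite inE => /andP [aA aB].
(* If C avoids the common point a of A and B, then A, B, C are the sides of a triangle abc, and any
   D meeting all three is one of them. *)
case: (boolP [forall C in E, a \in C]) => [/forall_inP aE | ]; first by exists a.
case/forall_inPn => C CE aC.
have /set0Pn [b] := EE _ _ CE AE; rewrite inE => /andP [bC bA].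
have /set0Pn [c] := EE _ _ CE BE; rewrite inE => /andP [cC cB].
have ab : a != b by apply: contraNneq aC => ->.
have ac : a != c by apply: contraNneq aC => ->.
have eA := card2_set2 (E2 _ AE) aA bA ab.
have eB := card2_set2 (E2 _ BE) aB cB ac.
have bc : b != c by apply: contraNneq AB => bc; rewrite eA eB bc.
have eC := card2_set2 (E2 _ CE) bC cC bc.
suff /subset_leq_card : E \subset [set A; B; C].
  have : #|[set A; B; C]| <= 3.
    by rewrite -setUA cardsU1 cards2; case: (_ \notin _); case: (_ != _).
  by move=> le3 /(leq_trans E3) /leq_trans /(_ le3).
apply/subsetP => D DE; rewrite !inE.
have /set0Pn [x] := EE _ _ DE AE; rewrite inE {1}eA !inE => /andP [xD /orP xab].
have /set0Pn [y] := EE _ _ DE BE; rewrite inE {1}eB !inE => /andP [yD /orP yac].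
have /set0Pn [z] := EE _ _ DE CE; rewrite inE {1}eC !inE => /andP [zD /orP zbc].
have D2 := E2 _ DE.
have [aD | aD] := boolP (a \in D).
  case: zbc => /eqP ez; rewrite ez in zD.
    by rewrite (card2_set2 D2 aD zD ab) -eA eqxx.
  by rewrite (card2_set2 D2 aD zD ac) -eB eqxx orbT.
have bD : b \in D by case: xab => /eqP ex; [rewrite -ex xD in aD | rewrite -ex].
have cD : c \in D by case: yac => /eqP ex; [rewrite -ex yD in aD | rewrite -ex].
by rewrite (card2_set2 D2 bD cD bc) -eC eqxx !orbT.
Qed.

Lemma sum_cover_le (T I : finType) (P : pred T) (Q : I -> pred T) (w : T -> nat) :
  (forall x, P x -> exists i, Q i x) ->
  \sum_(x | P x) w x <= \sum_i \sum_(x | Q i x) w x.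
Proof.
move=> PQ; rewrite (exchange_big_dep predT) //= big_mkcond /=.
apply: leq_sum => x _; case: ifP => // /PQ [i Qi].
by rewrite (bigD1 i) //= leq_addr.
Qed.

(** An x lying in some Q i but in no [E i j] is counted for a single i and satisfies P; every other
    occurrence is charged to some [E i j]. E may exceed the overlaps of the Q i, so it can also
    absorb the x that violate P. *)
Lemma bonferroni (T I : finType) (P : pred T) (Q : I -> pred T)
    (E : I -> I -> pred T) (w : T -> nat) :
  (forall i x, Q i x -> (forall j, j != i -> ~~ E i j x) -> P x) ->
  (forall i j x, j != i -> Q i x -> Q j x -> E i j x) ->
  \sum_i \sum_(x | Q i x) w x <=
    \sum_(x | P x) w x + \sum_i \sum_(j | j != i) \sum_(x | E i j x) w x.
Proof.
move=> QP QQ.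
pose good i x := Q i x && [forall (j | j != i), ~~ E i j x].
have -> : \sum_i \sum_(x | Q i x) w x =
    \sum_i \sum_(x | good i x) w x +
    \sum_i \sum_(x | Q i x && ~~ [forall (j | j != i), ~~ E i j x]) w x.
  by rewrite -big_split; apply: eq_bigr => i _;
    rewrite (bigID (fun x => [forall (j | j != i), ~~ E i j x])).
apply: leq_add.
  rewrite (exchange_big_dep predT) //= [leqRHS]big_mkcond.
  apply: leq_sum => x _.
  case: (pickP (good^~ x)) => [i /= /[dup] gi /andP [Qi /forall_inP Ei] | g0].
    rewrite (QP i x Qi) // (bigD1 i) //= big_pred0 ?addn0 // => j.
    apply/negP => /andP [/andP [Qj _] ji].
    by have := Ei j ji; rewrite (QQ i j x).
  by rewrite big_pred0.
apply: leq_sum => i _; rewrite (exchange_big_dep predT) //= big_mkcond.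
apply: leq_sum => x _; case: ifP => // /andP [_ /forall_inPn [j ji]].
rewrite negbK => Ej.
by rewrite (bigD1 j) /= ?leq_addr //; apply/andP; split.
Qed.

(** Subtract the sum over subfamilies of A from the one over subfamilies of [B |: A]; the latter is
    larger by the factor [weight B + 1]. *)
Lemma sum_fweight_rooted (n : nat) (B : {set 'I_n}) (A : {set {set 'I_n}}) :
  B \notin A ->
  \sum_(F : {set {set 'I_n}} | (B \in F) && (F \subset B |: A)) fweight F =
  weight B * 2 ^ mu A.
Proof.
move=> BA; have := sum_fweight_subset (B |: A).
rewrite {1}/mu big_setU1 // expnD -weightS mulSn [RHS]addnC.
rewrite (bigID (fun F : {set {set 'I_n}} => B \in F)) /=.
rewrite (eq_bigl _ _ (fun F => andbC _ _)).
rewrite [X in _ + X](eq_bigl (fun F : {set {set 'I_n}} => F \subset A)).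
  by rewrite sum_fweight_subset => /addIn.
move=> F; apply/andP/idP => [[FA BF] | FA].
  by rewrite -(setU1K BA) subsetD1 FA.
split; first exact: subset_trans FA (subsetU1 _ _).
by apply: contra BA => /(subsetP FA).
Qed.

(** * Classification and counting of the non-trivial families *)

Section Families.

Variable n : nat.
Implicit Types (i j : 'I_n) (S B : {set 'I_n}) (F M X Y : {set {set 'I_n}}).

(* These families carry the main term of R n. *)
Definition rooted i F : bool :=
  (~: [set i] \in F) && (F \subset ~: [set i] |: (star i :\ [set i])).

(** Meant for one or two missing pairs. The size condition on members avoiding i is what the count
    of such families relies on. *)
Definition almost_star (M : {set {set 'I_n}}) : bool :=
  [&& selfdual M, level M 1 == set0, #|level M 2| < n - 1 &
      [exists i, [forall B in M, (i \notin B) ==> (n - 3 <= #|B|)]]].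

(** A star has n - 1 pairs, so at least three are missing here. *)
Definition far_from_star (M : {set {set 'I_n}}) : bool :=
  [&& selfdual M, level M 1 == set0 & #|level M 2| + 4 <= n].

Lemma mem_kerP F j :
  reflect {in F, forall S : {set 'I_n}, j \in S} (j \in Defs.ker F).
Proof. exact: bigcapP. Qed.

(** Each pair contains i and must meet B in its other point, which determines the pair. *)
Lemma level2_missing M i B :
  selfdual M -> {in level M 2, forall S : {set 'I_n}, i \in S} ->
  B \in M -> i \notin B -> #|level M 2| <= #|B|.
Proof.
case/selfdualP=> MM _ iM BM iB.
apply: leq_trans (leq_imset_card (fun j => [set i; j]) B).
apply: subset_leq_card; apply/subsetP => S SM2.
have := SM2; rewrite inE => /andP [SM /eqP S2].
have /set0Pn [j] := MM _ _ SM BM; rewrite inE => /andP [jS jB].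
apply/imsetP; exists j => //; apply: card2_set2 => //; first exact: iM.
by apply: contraNneq iB => ->.
Qed.

Lemma nontrivial_cases F : 6 < n -> intersecting F -> nontrivial F ->
  [\/ exists i, rooted i F, exists2 M, almost_star M & F \subset M |
      exists2 M, far_from_star M & F \subset M].
Proof.
move=> n6 Fint /eqP ker0.
have n0 : 0 < n by lia.
have [M sdM FM] := selfdual_extension n0 Fint.
have [MM _] := elimT (selfdualP _) sdM.
have noker j : ~ {in F, forall S : {set 'I_n}, j \in S}.
  by move/mem_kerP; rewrite ker0 inE.
(* A singleton in M would put its point into every member of F, against the empty kernel. *)
have lvl1 : level M 1 == set0.
  apply/eqP/setP => S; rewrite !inE; apply/negP => /andP [SM /cards1P [j ej]].
  apply: (noker j) => A /(subsetP FM) AM.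
  by have /set0Pn [x] := MM _ _ SM AM; rewrite ej !inE => /andP [/eqP ->].
case: (leqP (#|level M 2| + 4) n) => c2.
  by apply: Or33; exists M => //; apply/and3P.
have [i iM] : exists i, {in level M 2, forall A : {set 'I_n}, i \in A}.
  apply: intersecting_edges_star.
  - by move=> A; rewrite inE => /andP [_ /eqP].
  - by move=> A B; rewrite !inE => /andP [AM _] /andP [BM _]; apply: MM.
  (* More than n - 4 pairs are present; [6 < n] makes that at least four, which rules out a
     triangle. *)
  - have lt3 m : n < m + 4 -> 3 < m by lia.
    exact: lt3 c2.
have missing B : B \in M -> i \notin B -> #|level M 2| <= #|B|.
  exact: level2_missing.
have [c2' | c2'] := ltnP #|level M 2| (n - 1).
  apply: Or32; exists M => //; apply/and4P; split=> //.
  apply/existsP; exists i; apply/forall_inP => B BM; apply/implyP => iB.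
  have le3 m : n < m + 4 -> n - 3 <= m by lia.
  exact: leq_trans (le3 _ c2) (missing B BM iB).
apply: Or31; exists i.
(* With no pair missing, a member avoiding i has at least n - 1 points, hence is [~: [set i]]. *)
have FB B : B \in F -> i \notin B -> B = ~: [set i].
  move=> /(subsetP FM) BM iB; apply/eqP.
  rewrite eqEcard cardsC1 card_ord subsetC sub1set inE iB /=.
  by rewrite -subn1; apply: leq_trans c2' (missing B BM iB).
have [B BF iB] : exists2 B, B \in F & i \notin B.
  apply/exists_inP; rewrite -[X in is_true X]negbK; apply/negP => /exists_inPn iF.
  by apply: (noker i) => S /iF; rewrite negbK.
apply/andP; split; first by rewrite -(FB _ BF iB).
apply/subsetP => A AF; rewrite !inE; have [iA | iA] := boolP (i \in A).
  rewrite andbT; apply/orP; right; apply/eqP => eA.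
  have : A \in level M 1 by rewrite inE (subsetP FM) // eA cards1.
  by rewrite (eqP lvl1) inE.
by rewrite (FB _ AF iA) eqxx.
Qed.

Lemma almost_star_mu M : 4 < n -> almost_star M ->
  mu M + (2 ^ (n - 1) - 2) + (2 ^ (n - 2) - 4) <= 3 ^ (n - 1).
Proof.
move=> n4 /and4P [sdM /eqP l1 l2 _].
apply: leq_trans (mu_deficit n4 sdM); rewrite l1 cards0 subn0 mul1n leq_add2l.
by apply: leq_pmull; lia.
Qed.

Lemma far_from_star_mu M : 4 < n -> far_from_star M ->
  mu M + (2 ^ (n - 1) - 2) + 3 * (2 ^ (n - 2) - 4) <= 3 ^ (n - 1).
Proof.
move=> n4 /and3P [sdM /eqP l1 l2].
apply: leq_trans (mu_deficit n4 sdM); rewrite l1 cards0 subn0 mul1n leq_add2l.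
by apply: leq_mul => //; lia.
Qed.

(* A self-dual family is determined by its trace on any X that meets every pair
   {S, ~: S}. *)
Lemma card_selfdual_le (O : pred {set {set 'I_n}}) X Y :
  (forall S, (S \in X) || (~: S \in X)) ->
  (forall M, O M -> selfdual M) -> (forall M, O M -> M :&: X \subset Y) ->
  #|O| <= 2 ^ #|Y|.
Proof.
move=> XC Osd OY; rewrite -card_powerset.
have inj : {in O &, injective (fun M : {set {set 'I_n}} => M :&: X)}.
  move=> M N MO NO /= e; have [_ sdM] := elimT (selfdualP _) (Osd _ MO).
  have [_ sdN] := elimT (selfdualP _) (Osd _ NO).
  have eX S : S \in X -> (S \in M) = (S \in N).
    move=> SX; have := congr1 (fun Z : {set {set 'I_n}} => S \in Z) e.
    by rewrite !inE SX !andbT.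
  apply/setP => S; case/orP: (XC S) => [/eX // | /eX].
  by rewrite sdM sdN => /(congr1 negb); rewrite !negbK.
rewrite -(card_in_imset inj); apply: subset_leq_card.
by apply/subsetP => _ /imsetP [M MO ->]; rewrite inE OY.
Qed.

Lemma card_star i : #|star i| = 2 ^ (n - 1).
Proof.
have <- : #|~: [set i]| = n - 1 by rewrite cardsC1 card_ord subn1.
rewrite -card_powerset -(card_preimset (star i) (@setC_inj 'I_n)).
by apply: eq_card => S; rewrite !inE subsetC sub1set inE.
Qed.

Lemma card_far_from_star : 0 < n -> #|far_from_star| <= 2 ^ (2 ^ (n - 1)).
Proof.
move=> n0; rewrite -(card_star (Ordinal n0)).
apply: (card_selfdual_le (X := star (Ordinal n0))).
- by move=> S; rewrite !inE orbN.
- by move=> M /and3P [].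
- by move=> M _; apply: subsetIr.
Qed.

(** Repetitions in [[set i; x; y]] cover the smaller sets, so pairs [(x, y)] encode them all. *)
Lemma card_small_star i : #|[set S in star i | #|S| <= 3]| <= n ^ 2.
Proof.
have <- : #|{: 'I_n * 'I_n}| = n ^ 2 by rewrite card_prod card_ord.
apply: leq_trans (leq_imset_card (fun p : 'I_n * 'I_n => [set i; p.1; p.2]) _).
apply: subset_leq_card; apply/subsetP => S; rewrite !inE => /andP [iS].
rewrite (cardsD1 i) iS add1n ltnS => c2; rewrite -(setD1K iS).
suff [x [y ->]] : exists x y, i |: (S :\ i) = [set i; x; y].
  by apply/imsetP; exists (x, y).
case e : #|S :\ i| c2 => [|[|[|k]]] // _.
- by exists i, i; rewrite (cards0_eq e) setU0 !setUid.
- have /eqP/cards1P [x ->] := e; by exists x, x; rewrite -setUA setUid.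
- have /eqP/cards2P [x [y [_ ->]]] := e; by exists x, y; rewrite setUA.
Qed.

(** For fixed i, M is determined by its members avoiding i; their complements contain i and have at
    most three points. *)
Lemma card_almost_star : #|almost_star| <= n * 2 ^ n ^ 2.
Proof.
pose O i M := almost_star M && [forall B in M, (i \notin B) ==> (n - 3 <= #|B|)].
have : #|almost_star| <= \sum_i #|O i|.
  rewrite -sum1_card (eq_bigr (fun i => \sum_(M | O i M) 1));
    last by move=> i _; rewrite sum1_card.
  apply: sum_cover_le => M /[dup] aM /and4P [_ _ _ /existsP [i iM]].
  by exists i; apply/andP.
move/leq_trans; apply.
suff cO i : #|O i| <= 2 ^ n ^ 2.
  by apply: leq_trans (leq_sum _ (fun i _ => cO i)) _;
    rewrite sum_nat_const card_ord.
apply: leq_trans (leq_pexp2l (isT : 0 < 2) (card_small_star i)).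
rewrite -(card_preimset [set S in star i | _] (@setC_inj 'I_n)).
apply: (card_selfdual_le (X := ~: star i)).
- by move=> S; rewrite !inE negbK orNb.
- by move=> M /andP [/and4P []].
move=> M /andP [_ /forall_inP iM]; apply/subsetP => S;
  rewrite !inE => /andP [SM iS].
rewrite iS /=; have := implyP (iM S SM) iS.
rewrite [#|~: S|]cardsCs setCK card_ord; lia.
Qed.

End Families.

(** * Upper and lower bounds for R and W *)

Lemma mu_star1 (n : nat) (i : 'I_n) :
  mu (star i :\ [set i]) = 3 ^ (n - 1) - 2 ^ (n - 1).
Proof.
rewrite [X in 3 ^ X]subn1 -(mu_star i) [mu (star i)]/mu (big_setD1 [set i]) /=;
  last by rewrite !inE.
by rewrite cards1 addKn.
Qed.

Lemma sum_rooted (n : nat) (i : 'I_n) :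
  \sum_(F | rooted i F) fweight F = 3 * 2 ^ (3 ^ (n - 1) - 2 ^ (n - 1)).
Proof.
rewrite sum_fweight_rooted; last by rewrite !inE eqxx andbF.
rewrite mu_star1 /weight cardsC1 card_ord -subn1 subKn //.
by have := ltn_ord i; lia.
Qed.

Lemma mu_setU1 (n : nat) (B : {set 'I_n}) (A : {set {set 'I_n}}) :
  mu (B |: A) <= 2 ^ (n - #|B|) + mu A.
Proof.
rewrite /mu; case: (boolP (B \in A)) => BA; last by rewrite big_setU1.
by rewrite (setUidPr _) ?leq_addl // sub1set.
Qed.

Lemma mu_starI (n : nat) (i j : 'I_n) : j != i ->
  mu (star i :&: star j) = 3 ^ (n - 2).
Proof.
move=> ji; have := mu_supersets [set i; j].
rewrite cards2 eq_sym ji => <-; congr (mu _).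
by apply/setP => S; rewrite !inE subUset !sub1set.
Qed.

Lemma R_le (n : nat) : 6 < n ->
  Defs.R n <= n * (3 * 2 ^ (3 ^ (n - 1) - 2 ^ (n - 1))) +
    (\sum_(M | @almost_star n M) 2 ^ mu M + \sum_(M | @far_from_star n M) 2 ^ mu M).
Proof.
move=> n6.
(* The sum type lets a single union bound cover the points i and the containing families M
   together. *)
pose Q (x : 'I_n + {set {set 'I_n}}) (F : {set {set 'I_n}}) : bool := match x with
  | inl i => rooted i F
  | inr M => (almost_star M || far_from_star M) && (F \subset M) end.
have := @sum_cover_le _ _ (fun F => intersecting F && nontrivial F) Q (@fweight n).
rewrite big_sumType /= => /(_ _)/leq_trans; apply.
  move=> F /andP [Fi Fn];
    case: (nontrivial_cases n6 Fi Fn) => [[i iF]|[M aM FM]|[M fM FM]].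
  - by exists (inl i).
  - by exists (inr M); rewrite /= aM FM.
  - by exists (inr M); rewrite /= fM orbT FM.
apply: leq_add.
  rewrite (eq_bigr (fun=> 3 * 2 ^ (3 ^ (n - 1) - 2 ^ (n - 1))));
    last by move=> i _; rewrite sum_rooted.
  by rewrite sum_nat_const card_ord.
rewrite [X in _ <= X + _]big_mkcond [X in _ <= _ + X]big_mkcond -big_split /=.
apply: leq_sum => M _; case: (boolP (_ || _)) => [aM | _];
  last by rewrite big_pred0.
rewrite sum_fweight_subset; case/orP: aM => ->; [exact: leq_addr | exact: leq_addl].
Qed.

Lemma quadratic_lt_exp (n : nat) : 9 < n -> n ^ 2 + n + 20 <= 2 ^ (n - 2).
Proof.
move=> n9; rewrite -(subnK n9); elim: (n - 10) => [//|k IH].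
have -> : k.+1 + 10 - 2 = (k + 10 - 2).+1 by lia.
rewrite [2 ^ _.+1]expnS; apply: leq_trans (leq_mul (leqnn 2) IH).
by rewrite -!mulnn; nia.
Qed.

(** Makes overlaps of exponent about [3 ^ (n - 2)] negligible against [3 ^ (n - 1)], even after
    scaling by [2 ^ (n + 2 ^ (n - 1))]. *)
Lemma exp2_le_exp3 (n : nat) : 9 < n -> 2 * n + 4 + 2 ^ (n - 1) <= 2 * 3 ^ (n - 2).
Proof.
move=> n9; rewrite -(subnK n9); elim: (n - 10) => [|k IH]; first by vm_compute.
have -> : k.+1 + 10 - 2 = (k + 10 - 2).+1 by lia.
have -> : k.+1 + 10 - 1 = (k + 10 - 1).+1 by lia.
by rewrite !expnS; lia.
Qed.

Lemma exp2_half (n : nat) : 1 < n -> 2 ^ (n - 1) = 2 * 2 ^ (n - 2).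
Proof. by move=> n1; rewrite -expnS; congr (2 ^ _); lia. Qed.

Lemma exp3_third (n : nat) : 1 < n -> 3 ^ (n - 1) = 3 * 3 ^ (n - 2).
Proof. by move=> n1; rewrite -expnS; congr (3 ^ _); lia. Qed.

(** Denominators are cleared to stay in [nat]: [n * 2 ^ 3 ^ (n - 1)], the total over all stars, is
    the reference scale for R and W, and [2 ^ n] sets the relative precision. *)
Lemma R_upper (n : nat) : 9 < n ->
  2 ^ n * Defs.R n * 2 ^ 2 ^ (n - 1) <= (3 * 2 ^ n + 1) * (n * 2 ^ 3 ^ (n - 1)).
Proof.
move=> n9; have n6 : 6 < n by lia.
have n4 : 4 < n by lia.
have n1 : 1 < n by lia.
have Eq := quadratic_lt_exp n9.
have le_almost : 2 ^ (n + 2 ^ (n - 1)) * (\sum_(M | @almost_star n M) 2 ^ mu M)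
    <= n * 2 ^ (3 ^ (n - 1) - 1).
  (* The [n ^ 2] held back pays for the number of almost-stars, and the 1 leaves half of the allowed
     error to the other sum. *)
  pose c := 3 ^ (n - 1) - 1 - n ^ 2.
  have b (M : {set {set 'I_n}}) : almost_star M ->
      2 ^ (n + 2 ^ (n - 1)) * 2 ^ mu M <= 2 ^ c.
    move=> aM; have := almost_star_mu n4 aM;
      rewrite -expnD leq_exp2l // /c exp2_half //; lia.
  rewrite big_distrr /=; apply: leq_trans (leq_sum _ b) _.
  rewrite sum_nat_const.
  apply: leq_trans (leq_mul (card_almost_star n) (leqnn _)) _.
  rewrite -mulnA -expnD leq_mul2l leq_exp2l // /c; apply/orP; right.
  have := exp2_le_exp3 n9; rewrite exp3_third // exp2_half //; lia.
have le_far : 2 ^ (n + 2 ^ (n - 1)) * (\sum_(M | @far_from_star n M) 2 ^ mu M)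
    <= n * 2 ^ (3 ^ (n - 1) - 1).
  (* Here the number of families costs [2 ^ (n - 1)], twice [2 ^ (n - 2)]; the loss from three
     missing pairs, about three times [2 ^ (n - 2)], outweighs it. *)
  pose c := 3 ^ (n - 1) - 1 - 2 ^ (n - 1).
  have b (M : {set {set 'I_n}}) : far_from_star M ->
      2 ^ (n + 2 ^ (n - 1)) * 2 ^ mu M <= 2 ^ c.
    move=> aM; have := far_from_star_mu n4 aM;
      rewrite -expnD leq_exp2l // /c exp2_half //; lia.
  rewrite big_distrr /=; apply: leq_trans (leq_sum _ b) _.
  rewrite sum_nat_const.
  apply: leq_trans (leq_mul (card_far_from_star (ltnW n1)) (leqnn _)) _.
  rewrite -expnD (_ : 2 ^ (n - 1) + c = 3 ^ (n - 1) - 1) ?leq_pmull //;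
    first by lia.
  have := exp2_le_exp3 n9; rewrite /c exp3_third // exp2_half //; lia.
have q_le_p : 2 ^ (n - 1) + 1 <= 3 ^ (n - 1).
  have := exp2_le_exp3 n9; rewrite exp3_third // exp2_half //; lia.
rewrite -mulnA [Defs.R n * _]mulnC mulnA -expnD.
apply: leq_trans (leq_mul (leqnn _) (R_le n6)) _.
rewrite mulnDr [X in _ <= X]mulnDl mul1n mulnDr; apply: leq_add.
  rewrite expnD (_ : 2 ^ 3 ^ (n - 1) =
    2 ^ 2 ^ (n - 1) * 2 ^ (3 ^ (n - 1) - 2 ^ (n - 1))); first by nia.
  by rewrite -expnD subnKC //; lia.
apply: leq_trans (leq_add le_almost le_far) _.
rewrite -mulnDr addnn -mul2n -expnS; apply: leq_mul => //; rewrite leq_exp2l //;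
  lia.
Qed.

Lemma R_lower (n : nat) : 9 < n ->
  3 * 2 ^ n * (n * 2 ^ 3 ^ (n - 1)) <=
  2 ^ n * Defs.R n * 2 ^ 2 ^ (n - 1) + n * 2 ^ 3 ^ (n - 1).
Proof.
move=> n9; have n1 : 1 < n by lia.
have E3 := exp2_le_exp3 n9.
(* A family rooted at i with j in its kernel, or rooted at both i and j, lies in
   E i j. *)
pose E (i j : 'I_n) (F : {set {set 'I_n}}) : bool :=
  F \subset ~: [set i] |: (~: [set j] |: (star i :&: star j)).
(* Each of the two complements of points adds 2 to the exponent of the double star, whence the 4. *)
have muE (i j : 'I_n) : j != i ->
    \sum_(F | E i j F) fweight F <= 2 ^ (3 ^ (n - 2) + 4).
  move=> ji; rewrite sum_fweight_subset leq_exp2l //.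
  apply: leq_trans (mu_setU1 _ _) _.
  have e k : 2 ^ (n - #|~: [set k : 'I_n]|) = 2.
    by rewrite cardsC1 card_ord (_ : n - n.-1 = 1) //; lia.
  rewrite e addnC (_ : 3 ^ _ + 4 = 3 ^ (n - 2) + 2 + 2) ?leq_add2r -?addnA //.
  by apply: leq_trans (mu_setU1 _ _) _; rewrite mu_starI // e addnC.
have := @bonferroni _ _ (fun F => intersecting F && nontrivial F)
  (@rooted n) E (@fweight n) => /(_ _ _) bonf.
have {bonf} : n * (3 * 2 ^ (3 ^ (n - 1) - 2 ^ (n - 1))) <=
    Defs.R n + n * (n * 2 ^ (3 ^ (n - 2) + 4)).
  have -> : n * (3 * 2 ^ (3 ^ (n - 1) - 2 ^ (n - 1))) =
      \sum_(i : 'I_n) \sum_(F | rooted i F) fweight F.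
    rewrite (eq_bigr (fun=> 3 * 2 ^ (3 ^ (n - 1) - 2 ^ (n - 1)))).
      by rewrite sum_nat_const card_ord.
    by move=> i _; rewrite sum_rooted.
  apply: leq_trans (bonf _ _) _.
  - move=> i F /andP [iF FA] noE; apply/andP; split.
      apply/intersectingP => A B /(subsetP FA) AF /(subsetP FA) BF.
      move: AF BF; rewrite !inE.
      move=> /orP [/eqP -> | /andP [Ai iA]] /orP [/eqP -> | /andP [Bi iB]].
      + by rewrite setIid -cards_eq0 cardsC1 card_ord; lia.
      + rewrite setIC -setDE setD_eq0 subset1 negb_or Bi.
        by rewrite -cards_eq0 (cardsD1 i) iB.
      + by rewrite -setDE setD_eq0 subset1 negb_or Ai -cards_eq0 (cardsD1 i) iA.
      + by apply/set0Pn; exists i; rewrite inE iA.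
    apply/eqP/setP => j; rewrite [RHS]inE; apply/negP => /mem_kerP jF.
    have ji : j != i by have := jF _ iF; rewrite !inE.
    have /negP := noE j ji; apply; apply/subsetP => A AF.
    move: (subsetP FA A AF);
      rewrite !inE (jF _ AF) andbT => /orP [-> // | /andP [_ ->]].
    by rewrite !orbT.
  - move=> i j F ji /andP [iF FA] /andP [jF FB]; apply/subsetP => A AF.
    move: (subsetP FA A AF) (subsetP FB A AF); rewrite !inE.
    by move=> /orP [-> // | /andP [_ ->]] /orP [-> | /andP [_ ->]]; rewrite ?orbT.
  have -> : n * (n * 2 ^ (3 ^ (n - 2) + 4)) =
      \sum_(i : 'I_n) \sum_(j : 'I_n) 2 ^ (3 ^ (n - 2) + 4).
    by rewrite !sum_nat_const card_ord.
  rewrite leq_add2l; apply: leq_sum => i _; rewrite big_mkcond;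
    apply: leq_sum => j _.
  by case: ifP => // /muE.
have q_le_p : 2 ^ (n - 1) <= 3 ^ (n - 1) by rewrite exp3_third //; lia.
move=> main.
have := leq_mul (leqnn (2 ^ n * 2 ^ 2 ^ (n - 1))) main.
have -> : 2 ^ n * 2 ^ 2 ^ (n - 1) * (n * (3 * 2 ^ (3 ^ (n - 1) - 2 ^ (n - 1)))) =
    3 * 2 ^ n * (n * 2 ^ 3 ^ (n - 1)).
  rewrite (_ : 2 ^ 3 ^ (n - 1) =
    2 ^ 2 ^ (n - 1) * 2 ^ (3 ^ (n - 1) - 2 ^ (n - 1))); first by nia.
  by rewrite -expnD subnKC.
move/leq_trans; apply; rewrite mulnDr; apply: leq_add; first by nia.
rewrite [X in X <= _]mulnCA leq_mul2l; apply/orP; right.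
have nlt : n <= 2 ^ n by apply: ltnW; apply: ltn_expl.
apply: leq_trans (leq_mul (leqnn _) (leq_mul nlt (leqnn _))) _.
rewrite -!expnD leq_exp2l // exp3_third //; lia.
Qed.

Lemma W_lower (n : nat) : 9 < n ->
  2 ^ n * (n * 2 ^ 3 ^ (n - 1)) <= 2 ^ n * Defs.W n + n * 2 ^ 3 ^ (n - 1).
Proof.
move=> n9; have n1 : 1 < n by lia.
have E3 := exp2_le_exp3 n9.
have main : n * 2 ^ 3 ^ (n - 1) <= Defs.W n + n * (n * 2 ^ 3 ^ (n - 2)).
  have -> : n * 2 ^ 3 ^ (n - 1) =
      \sum_(i : 'I_n) \sum_(F : {set {set 'I_n}} | F \subset star i) fweight F.
    rewrite (eq_bigr (fun=> 2 ^ 3 ^ (n - 1)));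
      first by rewrite sum_nat_const card_ord.
    by move=> i _; rewrite sum_fweight_subset mu_star subn1.
  apply: leq_trans (@bonferroni _ _ (@intersecting n)
    (fun (i : 'I_n) (F : {set {set 'I_n}}) => F \subset star i)
    (fun (i j : 'I_n) (F : {set {set 'I_n}}) => F \subset star i :&: star j)
      (@fweight n) _ _) _.
  - move=> i F /subsetP Fi _; apply/intersectingP => A B /Fi + /Fi.
    by rewrite !inE => iA iB; apply/set0Pn; exists i; rewrite inE iA.
  - by move=> i j F _ Fi Fj; rewrite subsetI Fi.
  have -> : n * (n * 2 ^ 3 ^ (n - 2)) =
      \sum_(i : 'I_n) \sum_(j : 'I_n) 2 ^ 3 ^ (n - 2).
    by rewrite !sum_nat_const card_ord.
  rewrite leq_add2l; apply: leq_sum => i _; rewrite big_mkcond;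
    apply: leq_sum => j _.
  by case: ifP => // ji; rewrite sum_fweight_subset mu_starI.
have := leq_mul (leqnn (2 ^ n)) main.
move/leq_trans; apply; rewrite mulnDr leq_add2l.
rewrite [X in X <= _]mulnCA leq_mul2l; apply/orP; right.
have nlt : n <= 2 ^ n by apply: ltnW; apply: ltn_expl.
apply: leq_trans (leq_mul (leqnn _) (leq_mul nlt (leqnn _))) _.
rewrite -!expnD leq_exp2l // exp3_third //; lia.
Qed.

(** A family with a kernel point lies in the star at that point; the remaining families sum to R,
    which [R_upper] makes negligible. *)
Lemma W_upper (n : nat) : 9 < n ->
  2 ^ n * Defs.W n <= (2 ^ n + 1) * (n * 2 ^ 3 ^ (n - 1)).
Proof.
move=> n9; have n1 : 1 < n by lia.
have main : Defs.W n <= n * 2 ^ 3 ^ (n - 1) + Defs.R n.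
  rewrite /Defs.W (bigID (@nontrivial n)) /= addnC leq_add2r.
  apply: leq_trans (@sum_cover_le _ _ _
    (fun (i : 'I_n) (F : {set {set 'I_n}}) => F \subset star i) _ _) _.
    move=> F /andP [_ /set0Pn [i /mem_kerP iF]]; exists i; apply/subsetP => A AF.
    by rewrite inE iF.
  rewrite (eq_bigr (fun=> 2 ^ 3 ^ (n - 1)));
    first by rewrite sum_nat_const card_ord.
  by move=> i _; rewrite sum_fweight_subset mu_star subn1.
have le_exp : 3 * 2 ^ n + 1 <= 2 ^ 2 ^ (n - 1).
  apply: (@leq_trans (2 ^ (n + 2))).
    by have := expn_gt0 2 n; rewrite expnD -[2 ^ 2]/4; lia.
  by rewrite leq_exp2l //; have := quadratic_lt_exp n9; rewrite exp2_half //; lia.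
have le_R : 2 ^ n * Defs.R n <= n * 2 ^ 3 ^ (n - 1).
  rewrite -(leq_pmul2r (expn_gt0 2 (2 ^ (n - 1)))).
  apply: leq_trans (R_upper n9) _.
  by rewrite mulnC leq_mul2l le_exp orbT.
apply: leq_trans (leq_mul (leqnn _) main) _.
by rewrite mulnDr mulnDl mul1n leq_add2l.
Qed.

(** * From the bounds to the limit of the ratio *)

(** The quotient lies between 3 - 4/(D + 1) and 3 + 4/(D - 1); since D is at least 2, an error of
    8/D covers both. *)
Lemma dist_ratio_le (K : realFieldType) (D A r w : K) :
  (2 <= D -> 0 < A -> 0 < w ->
   D * r <= (3 * D + 1) * A -> 3 * D * A <= D * r + A ->
   D * w <= (D + 1) * A -> D * A <= D * w + A ->
   `|r / w - 3| <= 8 * D^-1)%R.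
Proof.
move=> D2 A0 w0 rU rL wU wL.
have D0 : (0 < D)%R by lra.
have DA : (2 * A <= D * A)%R by rewrite ler_pM2r.
have h1 := ler_wpM2l (ltW D0) rU.
have h2 := ler_wpM2l (ltW D0) rL.
have c1 : (0 <= 3 * D + 8)%R by lra.
have h3 := ler_wpM2l c1 wL.
have c2 : (0 <= 3 * D)%R by lra.
have h4 := ler_wpM2l c2 wU.
have up : (D * (D * r) <= D * ((3 * D + 8) * w))%R by nra.
have lo : (D * (3 * D * w) <= D * (D * r + 8 * w))%R by nra.
rewrite ler_pM2l // in up; rewrite ler_pM2l // in lo.
have -> : (r / w - 3 = (r - 3 * w) / w)%R by rewrite mulrBl mulfK ?gt_eqF.
rewrite normrM normfV (gtr0_norm w0) ler_pdivrMr // -(ler_pM2l D0).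
have -> : (D * (8 / D * w) = 8 * w)%R.
  by rewrite mulrA [(D * _)%R]mulrC divfK ?gt_eqF.
rewrite -{1}(gtr0_norm D0) -normrM ler_norml; apply/andP; split; nra.
Qed.

Lemma dist_scaled_ratio_le (K : realFieldType) (n : nat) : 9 < n ->
  (`|(Defs.R n)%:R * 2 ^+ (2 ^ (n - 1))%N / (Defs.W n)%:R - 3| <=
     8 * (2 ^+ n)^-1 :> K)%R.
Proof.
move=> n9.
apply: (@dist_ratio_le K (2 ^+ n) (n%:R * 2 ^+ (3 ^ (n - 1))%N)).
- by rewrite -natrX (ler_nat _ 2) -{1}(expn1 2) leq_exp2l //; lia.
- by rewrite mulr_gt0 ?exprn_gt0 ?ltr0n //; lia.
- by rewrite ltr0n W_gt0.
- by have := R_upper n9; rewrite -(ler_nat K) !(natrM, natrX, natrD) !mulrA.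
- by have := R_lower n9; rewrite -(ler_nat K) !(natrM, natrX, natrD) !mulrA.
- by have := W_upper n9; rewrite -(ler_nat K) !(natrM, natrX, natrD) !mulrA.
- by have := W_lower n9; rewrite -(ler_nat K) !(natrM, natrX, natrD) !mulrA.
Qed.

From mathcomp Require Import all_classical all_reals all_analysis.
Import numFieldNormedType.Exports.
Local Open Scope classical_set_scope.
Local Open Scope ring_scope.

Theorem corollary5p10 (K : realType) :
  exists2 e : nat -> K, e n @[n --> \oo] --> (0 : K) &
  forall n : nat, (0 < n)%N ->
    Pr K (@Defs.nontrivial n) = (Defs.R n)%:R / (Defs.W n)%:R /\
    (Defs.R n)%:R / (Defs.W n)%:R = (3 + e n) * (2 ^+ (2 ^ (n - 1))%N)^-1 :> K.
Proof.
(* Solving the identity for e makes it hold for every n; only the limit needs the bounds, valid from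
   n = 10 on. *)
exists (fun n => (Defs.R n)%:R * 2 ^+ (2 ^ (n - 1))%N / (Defs.W n)%:R - 3).
  have lim0 : (fun n : nat => 8 * (2 ^+ n)^-1 : K) @ \oo --> (0 : K).
    rewrite -[X in _ --> X](mulr0 8); apply: cvgMr.
    under eq_fun do rewrite -exprVn.
    by apply: cvg_expr; rewrite ger0_norm ?invr_ge0 // invf_lt1 ?ltr1n.
  apply/norm_cvg0P; apply: (squeeze_cvgr _ (cvg_cst 0) lim0).
  exists 10 => // n /= n9; rewrite normr_ge0 /=; exact: dist_scaled_ratio_le.
move=> n _; split.
  (* The default value 0 of [pmf] restricts the sum to intersecting families. *)
  rewrite /Pr /pmf -big_mkcondr /= -mulr_suml -natr_sum; congr (_%:R / _).
  by apply: eq_bigl => F; rewrite andbC.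
by rewrite addrC subrK mulrAC mulfK // expf_neq0.
Qed.
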